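(* For a nonempty finite subset $E\subseteq\mathbb{N}$, the filter $\mathcal{F}_E$ is a maximal element of the poset $\mathfrak{F}\setminus\{\mathcal{F}_\infty\}$ if and only if there exists an odd prime $p\notin\Pi_E$ such that $A_E=\{2,p\}$.
   Context: $\mathbb{N}=\{1,2,\dots\}$, $\mathbb{N}_0=\{0\}\cup\mathbb{N}$, $\Pi$ the set of primes, $\Pi_z$ the set of prime divisors of $z$. The Kirch topology $\tau_K$ on $\mathbb{N}$ is generated by the base of all $a+b\mathbb{N}_0=\{a+bn:n\in\mathbb{N}_0\}$ with $a,b\in\mathbb{N}$ coprime and $b$ square-free. Closures $\overline{U}$ are in $\tau_K$; $\tau_x=\{U\in\tau_K:x\in U\}$. For finite $E\subseteq\mathbb{N}$, $\mathcal{F}_E=\{B\subseteq\mathbb{N}:\exists (U_x)_{x\in E}\in\prod_{x\in E}\tau_x\ (\bigcap_{x\in E}\overline{U_x}\subseteq B)\}$ (with $\mathcal{F}_\emptyset=\{\mathbb{N}\}$); $\mathcal{F}_\infty=\{B\subseteq\mathbb{N}:\exists n\in\mathbb{N}\ \exists U_1,\dots,U_n\in\tau_K\setminus\{\emptyset\}\ (\overline{U_1}\cap\dots\cap\overline{U_n}\subseteq B)\}$; and $\mathfrak{F}=\{\mathcal{F}_E:E\subseteq\mathbb{N}\text{ finite}\}\cup\{\mathcal{F}_\infty\}$, ordered by inclusion. For nonempty finite $E$: $\Pi_E=\bigcap_{z\in E}\Pi_z$ and $A_E=\{p\in\Pi:\exists k\in\mathbb{N}\ (E\subseteq p\mathbb{Z}\cup(k+p\mathbb{Z}))\}$.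 *)

(* Defs.v *)
(* MathComp (boot) world. Subsets of N = {1,2,...} are predicates on nat;
   only their values on positive naturals matter. *)
From mathcomp Require Import all_boot.
Set Implicit Arguments.
Unset Strict Implicit.
Unset Printing Implicit Defensive.

Definition nset := nat -> Prop.

Definition squarefree (b : nat) : Prop :=
  forall p, prime p -> ~ (p ^ 2 %| b).

Definition aprog (a b : nat) : nset := fun x => exists n, x = a + b * n.

Definition kirch_basic (a b : nat) : Prop :=
  0 < a /\ 0 < b /\ coprime a b /\ squarefree b.

Definition kirch_open (U : nset) : Prop :=
  (forall x, U x -> 0 < x) /\
  forall x, U x -> exists a b, kirch_basic a b /\ aprog a b x /\
                               (forall y, aprog a b y -> U y).

Definition kclosure (U : nset) : nset :=
  fun x => 0 < x /\ forall V, kirch_open V -> V x -> exists y, V y /\ U y.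

Definition FE (E : seq nat) : nset -> Prop :=
  fun B => exists U : nat -> nset,
    (forall x, x \in E -> kirch_open (U x) /\ U x x) /\
    (forall y, 0 < y -> (forall x, x \in E -> kclosure (U x) y) -> B y).

Definition Finf : nset -> Prop :=
  fun B => exists (n : nat) (Us : nat -> nset),
    0 < n /\
    (forall i, i < n -> kirch_open (Us i) /\ exists y, Us i y) /\
    (forall y, 0 < y -> (forall i, i < n -> kclosure (Us i) y) -> B y).

Definition fsub (F G : nset -> Prop) : Prop := forall B, F B -> G B.
Definition feq (F G : nset -> Prop) : Prop := fsub F G /\ fsub G F.

Definition finite_pos (E : seq nat) : Prop := forall x, x \in E -> 0 < x.

Definition maximal_FE (E : seq nat) : Prop :=
  ~ feq (FE E) Finf /\
  forall E' : seq nat, finite_pos E' -> ~ feq (FE E') Finf ->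
    fsub (FE E) (FE E') -> fsub (FE E') (FE E).

Definition in_PiE (E : seq nat) (p : nat) : Prop :=
  prime p /\ forall z, z \in E -> p %| z.

Definition in_AE (E : seq nat) (p : nat) : Prop :=
  prime p /\ exists k, 0 < k /\
    forall z, z \in E -> (p %| z) \/ z = k %[mod p].

(* Main.v *)
(* Call y q-adherent to E when q divides y or y is congruent mod q to every
   element of E prime to q.  Since two progressions with square-free moduli
   meet iff they agree modulo every common prime of the moduli, the closure of
   any open set around x contains the y that are q-adherent to x at all primes
   q below some bound, and the closure of x + (prod_{q < N, q prime to x} q) N_0
   consists of such y for the bound N.  So F_E is the filter of sets
   containing all y that are q-adherent to E for every prime q below some
   bound, and by the Chinese remainder theorem these filters compare prime by
   prime: F_E is contained in F_E' iff, at every prime, adherence to E'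
   implies adherence to E.  The primes with a nonzero adherent residue are
   exactly those of A_E, and 2 is always one; hence F_E = F_infinity iff A_E
   has no odd prime.  If p is an odd prime of A_E with nonzero adherent
   residue k, the progression k, k + p, k + 2p has p as its only odd A-prime
   and its filter lies above F_E; maximality makes the two filters equal,
   which says A_E = {2, p} and p is not in Pi_E.  Conversely, under that
   condition any E' whose filter lies above F_E and differs from F_infinity
   has p as its only odd A-prime, with the same adherent residue. *)

Require Import Defs.
From mathcomp Require Import all_boot zify.
From Stdlib Require Import Classical.
Set Implicit Arguments.
Unset Strict Implicit.
Unset Printing Implicit Defensive.

Lemma coprime_of_prime_divisors m n :
  (forall p, prime p -> p %| m -> ~~ (p %| n)) -> coprime m n.
Proof.
move=> H; case: (ltngtP (gcdn m n) 1) => [g_lt1 | g_gt1 | /eqP //].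
  have g0 : gcdn m n = 0 by apply/eqP; rewrite -leqn0 -ltnS.
  have [m0 n0] : m = 0 /\ n = 0.
    by split; apply/eqP; rewrite -dvd0n -g0 ?dvdn_gcdl ?dvdn_gcdr.
  by have := H 2; rewrite m0 n0 dvdn0; apply.
have p_g := pdiv_dvd (gcdn m n).
have := H _ (pdiv_prime g_gt1) (dvdn_trans p_g (dvdn_gcdl m n)).
by rewrite (dvdn_trans p_g (dvdn_gcdr m n)).
Qed.

Lemma squarefree_coprime m n : squarefree (m * n) -> coprime m n.
Proof.
move=> sq_mn; apply: coprime_of_prime_divisors => p p_pr p_m; apply/negP => p_n.
by apply: (sq_mn p p_pr); rewrite expnS expn1 dvdn_mul.
Qed.

Lemma prime_squarefree p : prime p -> squarefree p.
Proof.
move=> p_pr q q_pr; rewrite pfactor_dvdn ?prime_gt0 // logn_prime //.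
by case: eqP.
Qed.

Lemma squarefree_eqmod g u v : 0 < g -> squarefree g ->
  (forall q, prime q -> q %| g -> u = v %[mod q]) -> u = v %[mod g].
Proof.
move=> g_gt0 sq_g uv; apply/eqP/(modn_partP _ _ g_gt0) => q.
rewrite mem_primes => /and3P [q_pr _ q_g].
have log1 : logn q g = 1.
  have := sq_g q q_pr; rewrite pfactor_dvdn // => /negP.
  by move: q_g; rewrite -{1}(expn1 q) pfactor_dvdn //; lia.
by rewrite p_part log1 expn1; apply: uv.
Qed.

Lemma eqmodDr_dvdn m d q : m + d = m %[mod q] -> q %| d.
Proof. by move/eqP; rewrite -{2}[m]addn0 eqn_modDl mod0n. Qed.

Lemma aprog_eqmod a b x q : aprog a b x -> q %| b -> x = a %[mod q].
Proof. by move=> [n ->] /dvdnP [c ->]; rewrite mulnAC addnC modnMDl. Qed.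

Lemma aprog_of_eqmod a b x : a <= x -> x = a %[mod b] -> aprog a b x.
Proof.
move=> a_x xa; have /dvdnP [n def_n] : b %| x - a by rewrite -eqn_mod_dvd // xa.
by exists n; lia.
Qed.

Lemma aprog_coprime a b x : coprime a b -> aprog a b x -> coprime x b.
Proof. by move=> ab [n ->]; rewrite -coprime_modl addnC mulnC modnMDl coprime_modl. Qed.

Lemma kirch_open_aprog a b : kirch_basic a b -> kirch_open (aprog a b).
Proof.
move=> ab; have [a_gt0 _] := ab; split; first by move=> x [n ->]; lia.
by move=> x ab_x; exists a, b.
Qed.

Lemma kirch_basic_prime q y : prime q -> ~~ (q %| y) -> 0 < y -> kirch_basic y q.
Proof.
move=> q_pr q_y y_gt0; do !split => //; first exact: prime_gt0.
  by rewrite coprime_sym prime_coprime.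
exact: prime_squarefree.
Qed.

Lemma aprog_meet a b c d : kirch_basic a b -> kirch_basic c d ->
  (forall q, prime q -> q %| b -> q %| d -> a = c %[mod q]) ->
  exists z, aprog a b z /\ aprog c d z.
Proof.
move=> [a_gt0 [b_gt0 [_ _]]] [c_gt0 [d_gt0 [_ sq_d]]] ac.
set g := gcdn b d; set d' := d %/ g.
have def_d : d = d' * g by rewrite divnK ?dvdn_gcdr.
have sq_d'g : squarefree (d' * g) by rewrite -def_d.
have b_d' : coprime b d'.
  apply: coprime_of_prime_divisors => p p_pr p_b; apply/negP => p_d'.
  have p_g : p %| g by rewrite dvdn_gcd p_b def_d dvdn_mulr.
  have := coprime_dvdl p_d' (squarefree_coprime sq_d'g).
  by rewrite prime_coprime // p_g.
set z0 := chinese b d' a c.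
have z0_a : z0 = a %[mod b] := chinese_modl b_d' a c.
have z0_c : z0 = c %[mod d].
  apply: squarefree_eqmod => // q q_pr q_d.
  have [q_d' | q_nd'] := boolP (q %| d').
    by rewrite -(modn_dvdm z0 q_d') chinese_modr // modn_dvdm.
  have q_b : q %| b.
    move: q_d; rewrite def_d Euclid_dvdM // (negbTE q_nd') /=.
    by move/dvdn_trans; apply; apply: dvdn_gcdl.
  by rewrite -(modn_dvdm z0 q_b) z0_a modn_dvdm // ac.
have bd_gt0 : 0 < b * d by rewrite muln_gt0 b_gt0.
have ac_le : a + c <= z0 + (a + c) * (b * d).
  exact: leq_trans (leq_pmulr _ bd_gt0) (leq_addl _ _).
exists (z0 + (a + c) * (b * d)); split; apply: aprog_of_eqmod.
- exact: leq_trans (leq_addr c a) ac_le.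
- by rewrite mulnCA mulnC addnC modnMDl.
- exact: leq_trans (leq_addl a c) ac_le.
- by rewrite mulnA addnC modnMDl.
Qed.

Section PrimeProducts.

Variables (N : nat) (P : pred 'I_N).
Hypothesis P_prime : forall q, P q -> prime q.

Lemma prod_primes_gt0 : 0 < \prod_(q | P q) q.
Proof. by apply: prodn_cond_gt0 => q /P_prime/prime_gt0. Qed.

Lemma dvdn_prod_primes q : P q -> q %| \prod_(r | P r) r.
Proof. by move=> Pq; rewrite (bigD1 q) //= dvdn_mulr. Qed.

Lemma prime_dvd_prod_primes p : prime p -> p %| \prod_(q | P q) q ->
  exists2 q, P q & p = q.
Proof.
move=> p_pr; rewrite Euclid_dvd_prod // big_orE => /existsP [q /andP [Pq p_q]].
by exists q => //; apply/eqP; rewrite -dvdn_prime2 ?P_prime.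
Qed.

Lemma coprime_prod_primes x : (forall q, P q -> ~~ (q %| x)) ->
  coprime x (\prod_(q | P q) q).
Proof.
move=> Px; apply: coprime_of_prime_divisors => p p_pr p_x; apply/negP.
case/(prime_dvd_prod_primes p_pr) => q /Px q_x def_p.
by rewrite -def_p p_x in q_x.
Qed.

End PrimeProducts.

Lemma squarefree_prod_primes N (P : pred 'I_N) :
  (forall q, P q -> prime q) -> squarefree (\prod_(q | P q) q).
Proof.
move=> P_prime p p_pr p2_M.
have p_M : p %| \prod_(q | P q) q by apply: dvdn_trans p2_M; rewrite expnS dvdn_mulr.
have [q Pq def_p] := prime_dvd_prod_primes P_prime p_pr p_M.
rewrite (bigD1 q) //= -def_p expnS expn1 dvdn_pmul2l ?prime_gt0 // in p2_M.
have [|r /andP [_ r_q] def_r] := prime_dvd_prod_primes _ p_pr p2_M.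
  by move=> r /andP [/P_prime].
by move: r_q; rewrite -(inj_eq val_inj) /= -def_r def_p eqxx.
Qed.

Definition adherent (E : seq nat) (q y : nat) : Prop :=
  forall x, x \in E -> ~~ (q %| x) -> q %| y \/ y = x %[mod q].

Definition adherence_filter (E : seq nat) (B : nset) : Prop :=
  exists N, forall y, 0 < y ->
    (forall q, prime q -> q < N -> adherent E q y) -> B y.

Lemma kclosure_adherence U x : kirch_open U -> U x ->
  adherence_filter [:: x] (kclosure U).
Proof.
move=> [_ U_open] Ux; have [a [b [ab [ab_x ab_U]]]] := U_open x Ux.
exists b.+1 => y y_gt0 y_adh; split => // V [_ V_open] Vy.
have [c [d [cd [cd_y cd_V]]]] := V_open y Vy.
have [|z [ab_z cd_z]] := aprog_meet ab cd; last by exists z; split; auto.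
move=> q q_pr q_b q_d.
have [[_ [b_gt0 [co_ab _]]] [_ [_ [co_cd _]]]] := (ab, cd).
have q_x : ~~ (q %| x).
  rewrite -prime_coprime // coprime_sym.
  exact: coprime_dvdr q_b (aprog_coprime co_ab ab_x).
have q_y : ~~ (q %| y).
  rewrite -prime_coprime // coprime_sym.
  exact: coprime_dvdr q_d (aprog_coprime co_cd cd_y).
have q_lt : q < b.+1 by rewrite ltnS; apply: dvdn_leq.
have [q_y' | yx] := y_adh q q_pr q_lt x (mem_head _ _) q_x.
  by rewrite q_y' in q_y.
by rewrite -(aprog_eqmod ab_x q_b) -yx (aprog_eqmod cd_y q_d).
Qed.

Definition kirch_nbhd (N x : nat) : nset :=
  aprog x (\prod_(q < N | prime q && ~~ (q %| x)) q).

Lemma kirch_open_nbhd N x : 0 < x -> kirch_open (kirch_nbhd N x).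
Proof.
move=> x_gt0; apply: kirch_open_aprog.
have P_prime (q : 'I_N) : prime q && ~~ (q %| x) -> prime q by case/andP.
do !split => //.
- exact: prod_primes_gt0.
- by apply: coprime_prod_primes => q /andP [].
- exact: squarefree_prod_primes.
Qed.

Lemma kclosure_nbhd_adherent N x y q : kclosure (kirch_nbhd N x) y ->
  prime q -> q < N -> adherent [:: x] q y.
Proof.
move=> [y_gt0 y_cl] q_pr q_N x'; rewrite inE => /eqP -> q_x.
have [q_y | q_ny] := boolP (q %| y); [by left | right].
have y_y : aprog y q y by exists 0; rewrite muln0 addn0.
have [z [qy_z nbhd_z]] :=
  y_cl _ (kirch_open_aprog (kirch_basic_prime q_pr q_ny y_gt0)) y_y.
have q_M : q %| \prod_(r < N | prime r && ~~ (r %| x)) r.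
  by apply: (@dvdn_prod_primes N _ (Ordinal q_N)); rewrite /= q_pr q_x.
by rewrite -(aprog_eqmod qy_z (dvdnn q)) (aprog_eqmod nbhd_z q_M).
Qed.

Lemma adherent_subset (E E' : seq nat) q y : {subset E <= E'} ->
  adherent E' q y -> adherent E q y.
Proof. by move=> sub adh x /sub; apply: adh. Qed.

Lemma adherent_dvd E q y : q %| y -> adherent E q y.
Proof. by left. Qed.

Lemma adherent_eqmod E q y y' : y = y' %[mod q] -> adherent E q y -> adherent E q y'.
Proof.
move=> yy' adh x xE q_x; rewrite /dvdn -yy'.
by have [|->] := adh x xE q_x; [left | right].
Qed.

Lemma adherence_filterI A A' B B' (C : nset) :
  adherence_filter A B -> adherence_filter A' B' ->
  (forall y, B y -> B' y -> C y) -> adherence_filter (A ++ A') C.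
Proof.
move=> [N AB] [N' AB'] BC; exists (N + N') => y y_gt0 adh.
apply: BC; [apply: AB | apply: AB'] => // q q_pr q_lt.
- apply: adherent_subset (adh q q_pr _) => [x xA|]; first by rewrite mem_cat xA.
  lia.
- apply: adherent_subset (adh q q_pr _) => [x xA|]; first by rewrite mem_cat xA orbT.
  lia.
Qed.

Lemma adherence_filter_kclosures (s : seq nat) (U : nat -> nset) :
  (forall x, x \in s -> kirch_open (U x) /\ U x x) ->
  adherence_filter s (fun y => forall x, x \in s -> kclosure (U x) y).
Proof.
elim: s => [|x s IH] s_U; first by exists 0.
have [Ux_open Ux] := s_U x (mem_head _ _).
apply: (adherence_filterI (kclosure_adherence Ux_open Ux) (IH _)).
  by move=> x' x's; apply: s_U; rewrite inE x's orbT.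
by move=> y Ux_y Us_y x'; rewrite inE => /predU1P [-> | /Us_y].
Qed.

Lemma FE_adherenceP E B : finite_pos E -> FE E B <-> adherence_filter E B.
Proof.
move=> E_pos; split.
  move=> [U [E_U U_B]]; have [N adh] := adherence_filter_kclosures E_U.
  by exists N => y y_gt0 /(adh y y_gt0); apply: U_B.
move=> [N adh]; exists (kirch_nbhd N); split.
  move=> x xE; split; first exact: kirch_open_nbhd (E_pos x xE).
  by exists 0; rewrite muln0 addn0.
move=> y y_gt0 cl; apply: adh => // q q_pr q_N x xE.
exact: kclosure_nbhd_adherent (cl x xE) q_pr q_N x (mem_head _ _).
Qed.

Lemma FE_sub_Finf E : E <> [::] -> fsub (FE E) Finf.
Proof.
move=> E_n0 B [U [E_U U_B]]; exists (size E), (fun i => U (nth 0 E i)).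
split; first by case: E E_n0 {E_U U_B}.
split=> [i i_E | y y_gt0 cl].
  have [U_open U_x] := E_U _ (mem_nth 0 i_E).
  by split; last exists (nth 0 E i).
by apply: U_B => // x xE; rewrite -(nth_index 0 xE); apply: cl; rewrite index_mem.
Qed.

Lemma Finf_adherence B : Finf B -> exists A, adherence_filter A B.
Proof.
move=> [n [U [_ [U_open U_B]]]].
suff [A [N adh]] : exists A,
    adherence_filter A (fun y => forall i, i < n -> kclosure (U i) y).
  by exists A, N => y y_gt0 /(adh y y_gt0); apply: U_B.
elim: n U_open {U_B} => [|n IH] U_open; first by exists [::], 0.
have [Un_open [x Un_x]] := U_open n (ltnSn n).
have [|A adh] := IH; first by move=> i i_n; apply: U_open; apply: ltnW.
exists (x :: A).
apply: (adherence_filterI (kclosure_adherence Un_open Un_x) adh) => y Un_y U_y i.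
by rewrite ltnS leq_eqVlt => /predU1P [-> | /U_y].
Qed.

Lemma adherence_filter_residue A B q y : adherence_filter A B -> prime q ->
  adherent A q y -> exists2 y', y' = y %[mod q] & B y'.
Proof.
move=> [N adh] q_pr q_y.
pose P (r : 'I_N) := prime r && (r != q :> nat).
have P_prime r : P r -> prime r by case/andP.
set M := \prod_(r | P r) r.
have q_M : coprime q M.
  by apply: (coprime_prod_primes P_prime) => r /andP [r_pr r_q]; rewrite dvdn_prime2.
exists (chinese q M y 0 + q * M).
  by rewrite mulnC addnC modnMDl chinese_modl.
apply: adh => [|r r_pr r_N].
  have M_gt0 : 0 < M := prod_primes_gt0 P_prime.
  by rewrite addn_gt0 muln_gt0 (prime_gt0 q_pr) M_gt0 orbT.
have [-> | r_q] := eqVneq r q.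
  by apply: adherent_eqmod q_y; rewrite mulnC addnC modnMDl chinese_modl.
have r_M : r %| M by apply: (@dvdn_prod_primes N P (Ordinal r_N)); rewrite /P r_pr.
apply: adherent_dvd; apply: dvdn_add; last exact: dvdn_mull.
by rewrite /dvdn -(modn_dvdm _ r_M) chinese_modr // !mod0n.
Qed.

Lemma adherent2 E y : adherent E 2 y.
Proof.
move=> x _; rewrite dvdn2 negbK => x_odd.
have [y_odd | y_even] := boolP (odd y); [right | left]; last by rewrite dvdn2.
by rewrite !modn2 x_odd y_odd.
Qed.

Lemma in_AEP E q : prime q ->
  in_AE E q <-> exists2 k, ~~ (q %| k) & adherent E q k.
Proof.
move=> q_pr; split=> [[_ [k [_ Ek]]] | [k q_k adh]].
  have [q_k | q_nk] := boolP (q %| k).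
    exists 1; first by rewrite dvdn1 neq_ltn prime_gt1 ?orbT.
    move=> x xE q_x; have [q_x' | xk] := Ek x xE; first by rewrite q_x' in q_x.
    by move: q_x q_k; rewrite /dvdn xk => /negP.
  exists k => // x xE q_x; right.
  by have [q_x' | ->] := Ek x xE; first by rewrite q_x' in q_x.
split=> //; exists k; split; first by rewrite lt0n; apply: contraNneq q_k => ->.
move=> z zE; have [q_z | q_nz] := boolP (q %| z); [by left | right].
by have [q_k' | ->] := adh z zE q_nz; first by rewrite q_k' in q_k.
Qed.

Lemma adherent_notin_AE E q y : prime q -> ~ in_AE E q ->
  adherent E q y -> q %| y.
Proof.
move=> q_pr notA adh; apply/negPn/negP => q_y.
by apply: notA; apply/in_AEP => //; exists y.
Qed.

Lemma in_AE2 E : in_AE E 2.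
Proof. by apply/in_AEP => //; exists 1 => //; apply: adherent2. Qed.

Lemma adherent_residue (E : seq nat) q k x : x \in E -> ~~ (q %| x) ->
  ~~ (q %| k) -> adherent E q k ->
  forall y, adherent E q y <-> q %| y \/ y = k %[mod q].
Proof.
move=> xE q_x q_k adh_k y; split=> [adh_y | [/adherent_dvd // | yk]].
  have [|yx] := adh_y x xE q_x; first by left.
  have [q_k' | kx] := adh_k x xE q_x; first by rewrite q_k' in q_k.
  by right; rewrite yx kx.
by apply: adherent_eqmod adh_k; rewrite yk.
Qed.

Lemma notin_AE_progression3 k p q : prime p -> prime q -> odd q -> q != p ->
  ~ in_AE [:: k; k + p; k + p + p] q.
Proof.
move=> p_pr q_pr q_odd q_p /(in_AEP _ q_pr) [k' q_k' adh].
have q_np : ~~ (q %| p) by rewrite dvdn_prime2.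
have q_n2p : ~~ (q %| p + p).
  rewrite addnn -mul2n Euclid_dvdM // negb_or q_np andbT dvdn_prime2 //.
  by apply: contraTneq q_odd => ->.
set T := [:: k; k + p; k + p + p].
have same_residue z1 z2 : z1 \in T -> z2 \in T ->
    ~~ (q %| z1) -> ~~ (q %| z2) -> z1 = z2 %[mod q].
  move=> z1T z2T q_z1 q_z2.
  have [q_k'' | e1] := adh z1 z1T q_z1; first by rewrite q_k'' in q_k'.
  have [q_k'' | e2] := adh z2 z2T q_z2; first by rewrite q_k'' in q_k'.
  by rewrite -e1 e2.
have [T1 T2 T3] : [/\ k \in T, k + p \in T & k + p + p \in T].
  by rewrite !inE !eqxx ?orbT.
have [q_k | q_nk] := boolP (q %| k).
  have q_nkp : ~~ (q %| k + p) by rewrite dvdn_addr.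
  have q_nkpp : ~~ (q %| k + p + p) by rewrite -addnA dvdn_addr.
  by have /eqmodDr_dvdn := same_residue _ _ T3 T2 q_nkpp q_nkp; apply/negP.
have [q_kp | q_nkp] := boolP (q %| k + p).
  have q_nkpp : ~~ (q %| k + p + p) by rewrite dvdn_addr.
  have := same_residue _ _ T3 T1 q_nkpp q_nk.
  by rewrite -addnA => /eqmodDr_dvdn; apply/negP.
by have /eqmodDr_dvdn := same_residue _ _ T2 T1 q_nkp q_nk; apply/negP.
Qed.

Lemma FE_subP E E' : finite_pos E -> finite_pos E' ->
  fsub (FE E) (FE E') <->
  (forall q y, prime q -> adherent E' q y -> adherent E q y).
Proof.
move=> E_pos E'_pos; split=> [sub q y q_pr adh' | adh B].
  have E_q : FE E (adherent E q).
    by apply/FE_adherenceP => //; exists q.+1 => z _; apply.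
  have /(FE_adherenceP _ E'_pos) E'_q := sub _ E_q.
  have [y' y'y adh_y'] := adherence_filter_residue E'_q q_pr adh'.
  exact: adherent_eqmod adh_y'.
rewrite !FE_adherenceP // => -[N adh_B].
exists N => y y_gt0 adh_y; apply: adh_B => // q q_pr q_N.
exact/adh/adh_y.
Qed.

Lemma Finf_dvd p : prime p -> odd p -> Finf (fun y => p %| y).
Proof.
move=> p_pr p_odd; apply: (@FE_sub_Finf [:: 1; 1 + 2; 1 + 2 + 2]) => //.
apply/FE_adherenceP; first by move=> x; rewrite !inE => /or3P [] /eqP ->.
exists p.+1 => y _ adh; apply: (adherent_notin_AE p_pr _ (adh p p_pr (ltnSn p))).
by apply: notin_AE_progression3 => //; apply: contraTneq p_odd => ->.
Qed.

Lemma FE_eq_Finf E : E <> [::] -> finite_pos E ->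
  ~ (exists2 p, in_AE E p & odd p) -> feq (FE E) Finf.
Proof.
move=> E_n0 E_pos noA; split=> [|B /Finf_adherence [A [N adh]]].
  exact: FE_sub_Finf.
apply/FE_adherenceP => //; exists N => y y_gt0 adh_y; apply: adh => // q q_pr q_N.
have [-> | q_odd] := even_prime q_pr; first exact: adherent2.
apply/adherent_dvd/(adherent_notin_AE q_pr _ (adh_y q q_pr q_N)) => A_q.
by apply: noA; exists q.
Qed.

Lemma FE_neq_FinfP E : E <> [::] -> finite_pos E ->
  ~ feq (FE E) Finf <-> exists2 p, in_AE E p & odd p.
Proof.
move=> E_n0 E_pos; split=> [FE_Finf | [p A_p p_odd] [_ Finf_FE]].
  by apply: NNPP => noA; apply: FE_Finf; apply: FE_eq_Finf.
have p_pr : prime p by case: A_p.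
have [k p_k adh_k] := (in_AEP _ p_pr).1 A_p.
have /(FE_adherenceP _ E_pos) adh := Finf_FE _ (Finf_dvd p_pr p_odd).
have [y' y'k p_y'] := adherence_filter_residue adh p_pr adh_k.
by move: p_y' p_k; rewrite /dvdn y'k => ->.
Qed.

Lemma maximal_FE_AE E : E <> [::] -> finite_pos E -> maximal_FE E ->
  exists p, prime p /\ odd p /\ ~ in_PiE E p /\
            forall q, in_AE E q <-> (q = 2 \/ q = p).
Proof.
move=> E_n0 E_pos [FE_n max].
have [p A_p p_odd] := (FE_neq_FinfP E_n0 E_pos).1 FE_n.
have p_pr : prime p by case: A_p.
have [k p_k adh_k] := (in_AEP _ p_pr).1 A_p.
set T := [:: k; k + p; k + p + p].
have T_pos : finite_pos T.
  have k_gt0 : 0 < k by rewrite lt0n; apply: contraNneq p_k => ->.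
  by move=> x; rewrite !inE => /or3P [] /eqP ->; rewrite ?addn_gt0 ?k_gt0.
have T_k : adherent T p k.
  by move=> x; rewrite !inE => /or3P [] /eqP -> _; right; rewrite ?modnDr.
have T_p y : adherent T p y <-> p %| y \/ y = k %[mod p].
  exact: (adherent_residue (mem_head _ _) p_k p_k T_k y).
have T_q q y : prime q -> odd q -> q != p -> adherent T q y -> q %| y.
  by move=> q_pr q_odd q_p; apply/adherent_notin_AE/notin_AE_progression3.
have FE_T : ~ feq (FE T) Finf.
  by apply/FE_neq_FinfP => //; exists p => //; apply/in_AEP => //; exists k.
have E_T q y : prime q -> adherent T q y -> adherent E q y.
  move=> q_pr; have [-> _ | q_odd] := even_prime q_pr; first exact: adherent2.
  have [-> /T_p [/adherent_dvd // | yk] | q_p /T_q] := eqVneq q p.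
    by apply: adherent_eqmod adh_k; rewrite yk.
  by move/(_ q_pr q_odd q_p)/adherent_dvd.
have T_E := (FE_subP T_pos E_pos).1 (max T T_pos FE_T ((FE_subP E_pos T_pos).2 E_T)).
exists p; split=> //; split=> //; split=> [[_ Pi_p] | q].
  have : adherent E p (k + k) by move=> x /Pi_p ->.
  move/(T_E _ _ p_pr)/T_p => [| /eqmodDr_dvdn]; last by rewrite (negbTE p_k).
  rewrite addnn -mul2n Euclid_dvdM // (negbTE p_k) orbF dvdn_prime2 //.
  by apply/negP; apply: contraTneq p_odd => ->.
split=> [A_q | [-> | ->] //]; last exact: in_AE2.
have q_pr : prime q by case: A_q.
have [-> | q_odd] := even_prime q_pr; first by left.
have [-> | q_p] := eqVneq q p; first by right.
have [kq q_kq adh_kq] := (in_AEP _ q_pr).1 A_q.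
by have := T_q _ _ q_pr q_odd q_p (T_E _ _ q_pr adh_kq); rewrite (negbTE q_kq).
Qed.

Lemma AE_maximal_FE E p : E <> [::] -> finite_pos E -> prime p -> odd p ->
  ~ in_PiE E p -> (forall q, in_AE E q <-> (q = 2 \/ q = p)) -> maximal_FE E.
Proof.
move=> E_n0 E_pos p_pr p_odd Pi_p AE.
have A_p : in_AE E p by apply/AE; right.
split=> [|E' E'_pos FE'_n /(FE_subP E_pos E'_pos) E'_E].
  by apply/FE_neq_FinfP => //; exists p.
apply/(FE_subP E'_pos E_pos) => q y q_pr adh_y.
have [-> | /eqP E'_n0] := eqVneq E' [::]; first by [].
have [p' A'_p' p'_odd] := (FE_neq_FinfP E'_n0 E'_pos).1 FE'_n.
have p'_pr : prime p' by case: A'_p'.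
have [k p'_k adh'_k] := (in_AEP _ p'_pr).1 A'_p'.
have adh_k := E'_E _ _ p'_pr adh'_k.
have def_p' : p' = p.
  have /AE [p'2 | //] : in_AE E p' by apply/in_AEP => //; exists k.
  by move: p'_odd; rewrite p'2.
subst p'.
have [-> | q_odd] := even_prime q_pr; first exact: adherent2.
have [def_q | q_p] := eqVneq q p.
  subst q; have [/allP E_p | /allPn [x xE p_x]] := boolP (all (dvdn p) E).
    by case: Pi_p; split.
  have [/adherent_dvd // | yk] := (adherent_residue xE p_x p'_k adh_k y).1 adh_y.
  by apply: adherent_eqmod adh'_k; rewrite yk.
apply/adherent_dvd/(adherent_notin_AE q_pr _ adh_y) => /AE [q2 | qp].
  by move: q_odd; rewrite q2.
by move/eqP: q_p.
Qed.

Theorem lemma3p10 (E : seq nat) :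
  E <> [::] -> finite_pos E ->
  (maximal_FE E <->
   exists p, prime p /\ odd p /\ ~ in_PiE E p /\
             forall q, in_AE E q <-> (q = 2 \/ q = p)).
Proof.
move=> E_n0 E_pos; split; first exact: maximal_FE_AE.
by move=> [p [p_pr [p_odd [Pi_p AE]]]]; apply: (AE_maximal_FE _ _ p_pr p_odd).
Qed.
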